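(* Fix a real number $\rho>0$, integers $M\ge N\ge1$, and scalars $c_0,\dots,c_{N-1}>0$, and let $$\mathcal{C}(\mathbf{c};z^M;N,\rho):=\sum_{j=0}^{N-1}\binom{M}{j}^2\binom{M-j-1}{N-j-1}^2\frac{\rho^{M-j}}{c_j}.$$ For $A\in\mathcal{P}_N(\overline{D}(0,\rho))$ let $\mathcal{K}(A):=\ker\bigl(c_0\mathbf{1}_{N\times N}+c_1A+\cdots+c_{N-1}A^{\circ(N-1)}\bigr)\subset\mathbb{C}^N$. Then $$\inf_{\mathbf{v}\in\mathcal{K}(A)^\perp\setminus\{0\}}\frac{\mathbf{v}^*\Bigl(\sum_{j=0}^{N-1}c_jA^{\circ j}\Bigr)\mathbf{v}}{\mathbf{v}^*A^{\circ M}\mathbf{v}}\ \ge\ \mathcal{C}(\mathbf{c};z^M;N,\rho)^{-1}$$ for all non-zero $A\in\mathcal{P}_N(\overline{D}(0,\rho))$. The lower bound $\mathcal{C}(\mathbf{c};z^M;N,\rho)^{-1}$ is sharp, and may be obtained by considering only rank-one matrices with entries in $(0,\rho)$: the infimum of the left-hand side over all $A\in\mathcal{P}_N^1((0,\rho))$ equals $\mathcal{C}(\mathbf{c};z^M;N,\rho)^{-1}$.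
   Context: $\overline{D}(0,\rho)$ is the closed disc in $\mathbb{C}$ with center $0$ and radius $\rho$. $\mathcal{P}_N(K)$ is the set of positive semidefinite $N\times N$ matrices with entries in $K\subset\mathbb{C}$, and $\mathcal{P}_N^1(K)$ the subset of those of rank at most $1$. $A^{\circ k}:=(a_{ij}^k)$ is the $k$th Hadamard (entrywise) power, with $A^{\circ0}=\mathbf{1}_{N\times N}$ the matrix with all entries $1$. The orthogonal complement is taken in $\mathbb{C}^N$ with the standard inner product. For $\mathbf{v}\in\mathcal{K}(A)^\perp\setminus\{0\}$ the numerator is positive; the quotient is read as $+\infty$ when its denominator is $0$. *)

(* Defs.v *)
From HB Require Import structures.
From mathcomp Require Import all_boot all_order all_algebra.
From mathcomp Require Import complex.
From mathcomp Require Import all_classical all_reals all_analysis.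

Set Implicit Arguments.
Unset Strict Implicit.
Unset Printing Implicit Defensive.

Import Order.TTheory GRing.Theory Num.Theory.

Local Open Scope classical_set_scope.
Local Open Scope ring_scope.
Local Open Scope complex_scope.
Local Open Scope sesquilinear_scope.

Section Defs.
Context {R : realType}.

Definition closed_disc (rho : R) : set R[i] := [set z | `|z| <= rho%:C].

Definition open_segment (rho : R) : set R[i] :=
  [set x%:C | x in [set x : R | 0 < x < rho]].

(* The order on R[i] is partial: 0 <= z says that z is real and nonnegative. *)
Definition psdmx {N} (A : 'M[R[i]]_N) : Prop :=
  A \is hermsymmx /\ forall v : 'cV[R[i]]_N, 0 <= (v ^t* *m A *m v) 0 0.

Definition psd_over {N} (K : set R[i]) : set 'M[R[i]]_N :=
  [set A | psdmx A /\ forall i j, K (A i j)].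

Definition psd1_over {N} (K : set R[i]) : set 'M[R[i]]_N :=
  [set A | psd_over K A /\ (\rank A <= 1)%N].

(* x ^+ 0 = 1 also for x = 0, so the 0th power is the all-ones matrix. *)
Definition hadamard_exp {N} (A : 'M[R[i]]_N) (k : nat) : 'M[R[i]]_N :=
  map_mx (fun x => x ^+ k) A.

Definition hadamard_poly {N} (c : 'I_N -> R) (A : 'M[R[i]]_N) : 'M[R[i]]_N :=
  \sum_(j < N) (c j)%:C *: hadamard_exp A j.

Definition ker_poly {N} (c : 'I_N -> R) (A : 'M[R[i]]_N) : set 'cV[R[i]]_N :=
  [set u | hadamard_poly c A *m u = 0].

Definition ortho_compl {N} (U : set 'cV[R[i]]_N) : set 'cV[R[i]]_N :=
  [set v | forall u, U u -> (u ^t* *m v) 0 0 = 0].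

(* The real part loses nothing on Hermitian B, where v^* B v is real. *)
Definition qform {N} (B : 'M[R[i]]_N) (v : 'cV[R[i]]_N) : R :=
  complex.Re ((v ^t* *m B *m v) 0 0).

Definition rayleigh {N} (B D : 'M[R[i]]_N) (v : 'cV[R[i]]_N) : \bar R :=
  if qform D v == 0 then +oo%E else (qform B v / qform D v)%:E.

Definition inf_rayleigh {N} (c : 'I_N -> R) (M : nat) (A : 'M[R[i]]_N) : \bar R :=
  ereal_inf [set rayleigh (hadamard_poly c A) (hadamard_exp A M) v
            | v in ortho_compl (ker_poly c A) `\ 0].

Definition sharp_const {N} (c : 'I_N -> R) (M : nat) (rho : R) : R :=
  \sum_(j < N) ('C(M, j) ^ 2)%:R * ('C(M - j - 1, N - j - 1) ^ 2)%:R
               * (rho ^+ (M - j) / c j).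

End Defs.

(* Main.v *)
Require Import Defs.
From mathcomp Require Import all_boot all_order all_algebra.
From mathcomp Require Import complex polyrcf.
From mathcomp Require Import all_classical all_reals all_analysis.
From mathcomp Require Import ring zify.

(** Write F(A) for the sum of the c_j A^j (entrywise powers) and K for the
    constant of the theorem.  The lower bound says that K F(A) - A^M is positive
    semidefinite for every positive semidefinite N x N matrix A with entries in
    the disc of radius rho.

    For A = u u^* this is the Cauchy-Schwarz inequality.  Reducing X^M modulo
    the product of the X - u_i gives u_i^M as a combination of the u_i^j with
    j < N, and up to sign the coefficient of u_i^j is a hook Schur polynomial in
    the u_i ([hook_poly_interp]).  Its monomials have nonnegative coefficients,
    so its modulus is largest when all u_i equal sqrt rho
    ([hook_poly_coef_le]), where it is a product of two binomials times a power
    of sqrt rho ([coef_hook_nseq]).  Weighted Cauchy-Schwarz then gives exactly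
    the constant K ([rank1_bound]).

    A general A is reached from the rank-one case by the argument of FitzGerald
    and Horn ([hadamard_power_bound]).  A Schur complement writes A = U + B with
    U of rank one and B positive semidefinite with zero first row and column.
    With h(z) = K (sum of c_j z^j) - z^M, the derivative of h[U + t B] in t is
    the entrywise product of B and h'[U + t B].  Only the lower right
    block of size N - 1 matters, and there h' is a polynomial of the same kind
    for N - 1, M - 1 and the coefficients (j+1) c_(j+1).  By induction and the
    Schur product theorem it suffices that M times the constant of the smaller
    problem is at most K ([hook_const_deriv]).

    For sharpness, take distinct real nodes u_i just below sqrt rho and A = u u^T.
    The Vandermonde system is then invertible, so a vector v can be chosen for
    which Cauchy-Schwarz is an equality; the quotient at v is the inverse of the
    sum of the squared hook Schur polynomials divided by c_j, and tends to 1/K as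
    the nodes tend to sqrt rho ([inf_rayleigh_real_rank1], [sharpness]). *)

Set Implicit Arguments.
Unset Strict Implicit.
Unset Printing Implicit Defensive.

Import Order.TTheory GRing.Theory Num.Theory.

Local Open Scope classical_set_scope.
Local Open Scope ring_scope.

(** * Hook Schur polynomials and interpolation of a power *)

(** For nodes s = (x_0, ..., x_n) the coefficient of 'X^j in [hook_poly s k] is the
    Schur polynomial of the hook (k, 1^(n - j)) in these nodes (for k > 0), that is,
    up to sign, the coefficient of X^j in X^(n + k) modulo the product of the
    X - x_i.  The recursion comes from
    X^M - x X^(M-1) = (X - x) X^(M-1), reduced modulo (X - x) p, where p is the
    product over the other nodes; after the substitution of - X for X no
    subtraction is left, which makes the positivity of the coefficients visible. *)
Fixpoint hook_poly (F : comNzRingType) (s : seq F) : nat -> {poly F} :=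
  if s is x :: s' then
    fix hook_x k :=
      if k is k'.+1 then x%:P * hook_x k' + ('X + x%:P) * hook_poly s' k
      else 'X^(size s')
  else fun=> 0.

Arguments hook_poly : simpl never.

Section HookPoly.
Variable F : comNzRingType.
Implicit Types (x u : F) (s : seq F).

Lemma hook_poly_cons0 x s : hook_poly (x :: s) 0 = 'X^(size s).
Proof. by []. Qed.

Lemma hook_poly_consS x s k :
  hook_poly (x :: s) k.+1 =
  x%:P * hook_poly (x :: s) k + ('X + x%:P) * hook_poly s k.+1.
Proof. by []. Qed.

Lemma size_hook_poly s k : (size (hook_poly s k) <= size s)%N.
Proof.
elim: s k => [|x s IHs] k; first by rewrite size_poly0.
elim: k => [|k IHk]; first by rewrite hook_poly_cons0 size_polyXn.
rewrite hook_poly_consS (leq_trans (size_polyD _ _)) // geq_max; apply/andP; split.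
  by rewrite mul_polyC (leq_trans (size_scale_leq _ _)).
rewrite (leq_trans (size_polyMleq _ _)) // size_XaddC /=.
by rewrite ltnS.
Qed.

(** At a node the remainder of X^M takes the value of X^M.  Reading this node by
    node, and not as the solution of a linear system in the nodes, covers
    matrices u u^* with repeated entries without a limiting argument. *)
Lemma hook_poly_interp s k u : u \in s ->
  u ^+ ((size s).-1 + k) = (-1) ^+ (size s).-1 * (hook_poly s k).[- u].
Proof.
elim: s k => [//|x s IHs] k us.
elim: k => [|k IHk].
  by rewrite hook_poly_cons0 hornerXn addn0 -exprMn mulN1r opprK.
rewrite hook_poly_consS !hornerE [(size _).-1]/= mulrDr.
rewrite mulrCA -IHk [(size _).-1]/=.
move: us; rewrite inE => /orP[/eqP ->|us].
  by rewrite addNr mul0r mulr0 addr0 addnS exprS.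
have -> : u ^+ (size s + k.+1) =
    x * u ^+ (size s + k) + (u - x) * u ^+ ((size s).-1 + k.+1).
  have -> : ((size s).-1 + k.+1 = size s + k)%N.
    by case: (s) us => //= y s' _; rewrite addnS.
  by rewrite addnS exprS; ring.
rewrite (IHs k.+1 us); case: (s) us => //= y s' _.
by rewrite exprS; ring.
Qed.

Lemma coef_hook_consS x s k j :
  (hook_poly (x :: s) k.+1)`_j =
  x * (hook_poly (x :: s) k)`_j
  + ((if j is j'.+1 then (hook_poly s k.+1)`_j' else 0)
     + x * (hook_poly s k.+1)`_j).
Proof.
rewrite hook_poly_consS coefD coefCM mulrDl coefD coefXM coefCM.
by case: j.
Qed.

(** At equal nodes the recursion of [hook_poly] becomes Pascal's rule applied
    to each of the two binomial factors. *)
Lemma coef_hook_nseq n k j x : (j <= n)%N ->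
  (hook_poly (nseq n.+1 x) k)`_j =
  ('C(n + k, j) * 'C((n + k - j).-1, n - j))%:R * x ^+ (n + k - j).
Proof.
elim: n k j => [|n IHn] k j.
  rewrite leqn0 => /eqP->; rewrite add0n !subn0 !bin0 mul1n mul1r.
  elim: k => [|k IHk]; first by rewrite hook_poly_cons0 coefXn.
  by rewrite coef_hook_consS IHk /= coef0 mulr0 !addr0 exprS.
rewrite -[nseq n.+2 x]/(x :: nseq n.+1 x).
elim: k j => [|k IHk] j lejn.
  rewrite hook_poly_cons0 coefXn size_nseq addn0.
  move: lejn; rewrite leq_eqVlt => /orP[/eqP->|ltjn].
    by rewrite eqxx subnn binn /= bin0 mulr1.
  rewrite (ltn_eqF ltjn) [X in (_ * X)%N]bin_small ?muln0 ?mul0r //.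
  by lia.
rewrite coef_hook_consS IHk //.
have top : (hook_poly (nseq n.+1 x) k.+1)`_n.+1 = 0.
  by apply/leq_sizeP; [exact: size_hook_poly|rewrite size_nseq].
case: j lejn => [|j] lejn.
  rewrite IHn // !subn0 !bin0 !mul1n add0r ![x * (_ * _)]mulrCA -!exprS.
  by rewrite !addnS !addSn -mulrDl -natrD /=; congr (_%:R * _).
have -> : (n.+1 + k.+1 - j.+1 = (n.+1 + k - j.+1).+1)%N by lia.
rewrite IHn // !succnK [x * (_ * _)]mulrCA -exprS.
have -> : (n + k.+1 - j = (n.+1 + k - j.+1).+1)%N by lia.
move: lejn; rewrite leq_eqVlt => /orP[/eqP[->]|ltjn].
  rewrite top mulr0 addr0 !subnn !bin0 !muln1 -mulrDl -natrD.
  by rewrite [(n.+1 + k.+1)%N]addnS binS addSnnS.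
rewrite IHn //.
have -> : (n + k.+1 - j.+1 = n.+1 + k - j.+1)%N by lia.
rewrite ![x * (_ * _)]mulrCA -!exprS -!mulrDl -!natrD; congr (_%:R * _).
set a := (n.+1 + k - j.+1)%N.
have -> : (n.+1 + k.+1 = (n + k).+2)%N by lia.
have -> : (n + k.+1 = (n + k).+1)%N by lia.
have -> : (n.+1 + k = (n + k).+1)%N by lia.
have aS : a = a.-1.+1 by rewrite /a; lia.
have -> : (n.+1 - j.+1 = (n - j.+1).+1)%N by lia.
have -> : (n - j = (n - j.+1).+1)%N by lia.
by rewrite succnK aS succnK !binS; ring.
Qed.

End HookPoly.

(** Monotonicity of polynomials with nonnegative coefficients, read off the
    subtraction-free recursion. *)
Lemma hook_poly_coef_le (F : numDomainType) (s t : seq F) k j :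
  all2 (fun x y => `|x| <= y) s t ->
  `|(hook_poly s k)`_j| <= (hook_poly t k)`_j.
Proof.
elim: s t k j => [|x s IHs] [|y t] //= k j.
  by rewrite coef0 normr0.
move=> /andP[lexy lest].
have sz : size s = size t by apply/eqP; move: lest; rewrite all2E => /andP[].
elim: k j => [|k IHk] j.
  rewrite !hook_poly_cons0 sz.
  by rewrite !coefXn normr_nat.
rewrite !coef_hook_consS.
rewrite (le_trans (ler_normD _ _)) // lerD //.
  by rewrite normrM ler_pM ?IHk.
rewrite (le_trans (ler_normD _ _)) // lerD //.
  by case: j => [|j]; rewrite ?normr0 ?IHs.
by rewrite normrM ler_pM ?IHs.
Qed.

(** * Positive semidefinite kernels *)

(** This form keeps only an upper bound K of the first factor, and avoids the
    degenerate case where that factor vanishes: with S the sum of the a_j b_j,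
    expand the nonnegative sum of the c_j (K b_j - S a_j / c_j)^2. *)
Lemma weighted_cauchy_schwarz (F : numFieldType) (n : nat)
    (a b c : 'I_n -> F) (K : F) :
  (forall j, a j \is Num.real) -> (forall j, b j \is Num.real) ->
  (forall j, 0 < c j) -> 0 < K -> \sum_j a j ^+ 2 / c j <= K ->
  (\sum_j a j * b j) ^+ 2 <= K * \sum_j c j * b j ^+ 2.
Proof.
move=> ar br c0 K0 leK; set S := \sum_j _ * _; set Y := \sum_j c j * _.
have Sr : S \is Num.real by rewrite rpred_sum // => j _; rewrite rpredM.
have : 0 <= \sum_j c j * (b j * K - S * a j / c j) ^+ 2.
  apply: sumr_ge0 => j _; rewrite mulr_ge0 ?(ltW (c0 j)) //.
  have Kr : K \is Num.real by exact: gtr0_real.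
  have cr : c j \is Num.real by exact: gtr0_real.
  by rewrite real_exprn_even_ge0 // rpredB // !(rpredM, rpredV).
have -> : \sum_j c j * (b j * K - S * a j / c j) ^+ 2 =
    K ^+ 2 * Y - 2 * K * S ^+ 2 + S ^+ 2 * \sum_j a j ^+ 2 / c j.
  rewrite [K ^+ 2 * _]mulr_sumr [S ^+ 2 * _ in RHS]mulr_sumr.
  have -> : 2 * K * S ^+ 2 = \sum_j 2 * K * S * (a j * b j).
    by rewrite -mulr_sumr -/S expr2 mulrA.
  rewrite -sumrB -big_split.
  apply: eq_bigr => j _ /=.
  have cj0 : c j != 0 by rewrite gt_eqF.
  by field.
move=> h; have : 0 <= K * (K * Y - S ^+ 2).
  apply: le_trans h _; rewrite -subr_ge0.
  have -> : K * (K * Y - S ^+ 2) - (K ^+ 2 * Y - 2 * K * S ^+ 2 +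
      S ^+ 2 * \sum_j a j ^+ 2 / c j) = S ^+ 2 * (K - \sum_j a j ^+ 2 / c j).
    by ring.
  by rewrite mulr_ge0 ?subr_ge0 ?real_exprn_even_ge0.
by rewrite pmulr_rge0 // subr_ge0.
Qed.

(** Matrices are handled as functions of two indices, so that entrywise
    polynomials and products are plain lambda-expressions. *)
Definition form (C : numClosedFieldType) n (A : 'I_n -> 'I_n -> C)
    (v : 'I_n -> C) : C := \sum_i \sum_j (v i)^* * A i j * v j.

Definition psd_kernel (C : numClosedFieldType) n (A : 'I_n -> 'I_n -> C) :=
  (forall i j, A j i = (A i j)^*) /\ forall v, 0 <= form A v.

Section Forms.
Variable C : numClosedFieldType.
Implicit Types (n : nat).

Lemma eq_form n (A B : 'I_n -> 'I_n -> C) v :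
  (forall i j, A i j = B i j) -> form A v = form B v.
Proof. by move=> AB; do 2 (apply: eq_bigr => ? _); rewrite AB. Qed.

Lemma form_sum n (I : finType) (a : I -> C) (F : I -> 'I_n -> 'I_n -> C) v :
  form (fun i j => \sum_k a k * F k i j) v = \sum_k a k * form (F k) v.
Proof.
under [RHS]eq_bigr do rewrite mulr_sumr.
rewrite exchange_big; apply: eq_bigr => i _ /=.
under [RHS]eq_bigr do rewrite mulr_sumr.
rewrite exchange_big; apply: eq_bigr => j _ /=.
by rewrite mulr_sumr mulr_suml; apply: eq_bigr => k _; ring.
Qed.

Lemma form_lin n (A B : 'I_n -> 'I_n -> C) (a b : C) v :
  form (fun i j => a * A i j + b * B i j) v = a * form A v + b * form B v.
Proof.
rewrite /form !mulr_sumr -big_split; apply: eq_bigr => i _ /=.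
by rewrite !mulr_sumr -big_split; apply: eq_bigr => j _ /=; ring.
Qed.

Lemma form_outer n (x y v : 'I_n -> C) :
  form (fun i j => x i * y j) v = (\sum_i (v i)^* * x i) * \sum_j y j * v j.
Proof.
rewrite mulr_suml; apply: eq_bigr => i _; rewrite mulr_sumr.
by apply: eq_bigr => j _; ring.
Qed.

Lemma form_rank1 n (x v : 'I_n -> C) :
  form (fun i j => x i * (x j)^*) v = `|\sum_i (v i)^* * x i| ^+ 2.
Proof.
rewrite form_outer normCK rmorph_sum; congr (_ * _); apply: eq_bigr => j _.
by rewrite rmorphM /= conjCK mulrC.
Qed.

Lemma form_schur_rank1 n (x v : 'I_n -> C) G :
  form (fun i j => x i * (x j)^* * G i j) v = form G (fun i => (x i)^* * v i).
Proof.
do 2 (apply: eq_bigr => ? _).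
by rewrite rmorphM /= conjCK; ring.
Qed.

Lemma form_delta n (A : 'I_n -> 'I_n -> C) k l (a b : C) :
  form A (fun i => a *+ (i == k) + b *+ (i == l)) =
  a^* * A k k * a + a^* * A k l * b + b^* * A l k * a + b^* * A l l * b.
Proof.
have E k' l' c d : \sum_i \sum_j (c *+ (i == k'))^* * A i j * (d *+ (j == l'))
    = c^* * A k' l' * d.
  rewrite (bigD1 k') //= [X in _ + X]big1 ?addr0; last first.
    move=> i /negbTE ->; apply: big1 => j _.
    by rewrite mulr0n conjC0 !mul0r.
  rewrite (bigD1 l') //= [X in _ + X]big1 ?addr0 ?eqxx ?mulr1n //.
  by move=> j /negbTE ->; rewrite mulr0n mulr0.
rewrite -!E -!big_split; apply: eq_bigr => i _ /=.
rewrite -!big_split; apply: eq_bigr => j _ /=.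
by rewrite rmorphD /=; ring.
Qed.

Lemma psd_diag_ge0 n (A : 'I_n -> 'I_n -> C) i : psd_kernel A -> 0 <= A i i.
Proof.
case=> _ /(_ (fun j => 1 *+ (j == i) + 0 *+ (j == i))).
by rewrite form_delta !(conjC0, conjC1, mul0r, mulr0, addr0, mul1r, mulr1).
Qed.

(** The form at e_j + z e_i is affine along the ray where z is a negative
    multiple of the conjugate of A j i, hence negative far out unless the slope
    vanishes. *)
Lemma psd_zero_diag n (A : 'I_n -> 'I_n -> C) i j :
  psd_kernel A -> A i i = 0 -> A j i = 0.
Proof.
move=> psdA Aii; have [hA posA] := psdA; apply/eqP.
apply: contraT => Aji; set x := `|A j i| ^+ 2.
have x0 : 0 < x by rewrite exprn_gt0 ?normr_gt0.
have Ajj := psd_diag_ge0 j psdA.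
(* Chosen so that the form below equals A j j - 2 k x = - 1. *)
set k := (A j j + 1) / (2 * x).
have k0 : 0 <= k by rewrite divr_ge0 ?addr_ge0 ?mulr_ge0 ?(ltW x0).
have := posA (fun l => - k * (A j i)^* *+ (l == i) + 1 *+ (l == j)).
rewrite form_delta Aii mulr0 mul0r add0r conjC1 mul1r !mulr1.
rewrite rmorphM rmorphN /= conjCK (geC0_conj k0) (hA j i) mul1r.
have -> : - k * A j i * (A j i)^* + A j i * (- k * (A j i)^*) + A j j
    = A j j - k * (2 * x) by rewrite /x normCK; ring.
have x2 : 2 * x != 0 by rewrite mulf_neq0 ?pnatr_eq0 ?gt_eqF.
rewrite divfK //.
by rewrite opprD addrA subrr add0r oppr_ge0 lt_geF ?ltr01.
Qed.

Definition extend0 n (v : 'I_n -> C) (i : 'I_n.+1) : C :=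
  oapp v 0 (unlift ord0 i).

Lemma form_extend0 n (A : 'I_n.+1 -> 'I_n.+1 -> C) v :
  form A (extend0 v) = form (fun i j => A (lift ord0 i) (lift ord0 j)) v.
Proof.
rewrite /form big_ord_recl big1 ?add0r => [|j _]; last first.
  by rewrite /extend0 unlift_none conjC0 !mul0r.
apply: eq_bigr => i _; rewrite big_ord_recl /extend0 unlift_none mulr0 add0r.
by apply: eq_bigr => j _; rewrite !liftK.
Qed.

Lemma psd_lift n (A : 'I_n.+1 -> 'I_n.+1 -> C) : psd_kernel A ->
  psd_kernel (fun i j => A (lift ord0 i) (lift ord0 j)).
Proof. by case=> hA posA; split=> [i j|v]; [exact: hA|rewrite -form_extend0]. Qed.

Lemma form_lift n (B : 'I_n.+1 -> 'I_n.+1 -> C) v :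
  (forall i, B i ord0 = 0) -> (forall i, B ord0 i = 0) ->
  form B v = form (fun i j => B (lift ord0 i) (lift ord0 j))
    (fun i => v (lift ord0 i)).
Proof.
move=> Bi0 B0i; rewrite /form big_ord_recl big1 ?add0r => [|j _]; last first.
  by rewrite B0i mulr0 mul0r.
by apply: eq_bigr => i _; rewrite big_ord_recl Bi0 mulr0 mul0r add0r.
Qed.

(** One step of the Cholesky decomposition. *)
Lemma schur_complement n (A : 'I_n.+1 -> 'I_n.+1 -> C) : psd_kernel A ->
  exists u : 'I_n.+1 -> C, let B i j := A i j - u i * (u j)^* in
    [/\ forall i, B i ord0 = 0, forall i, B ord0 i = 0 & psd_kernel B].
Proof.
move=> psdA; have [hA posA] := psdA.
have [A00|A00] := eqVneq (A ord0 ord0) 0.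
  exists (fun=> 0) => B.
  have BE i j : B i j = A i j by rewrite /B mul0r subr0.
  have Ai0 i : A i ord0 = 0 by apply: psd_zero_diag A00.
  split=> [i|i|]; rewrite ?BE ?Ai0 //; first by rewrite hA Ai0 conjC0.
  split=> [i j|v]; first by rewrite !BE.
  by rewrite (eq_form _ BE).
have A00p : 0 < A ord0 ord0 by rewrite lt_def A00 psd_diag_ge0.
set r := sqrtC (A ord0 ord0).
have r0 : 0 < r by rewrite sqrtC_gt0.
have rr : r * r = A ord0 ord0 by rewrite -expr2 sqrtCK.
have rn0 : r != 0 by rewrite gt_eqF.
have rc : r^* = r by rewrite geC0_conj ?ltW.
exists (fun i => A i ord0 / r) => B.
have u0 : A ord0 ord0 / r = r by rewrite -rr mulfK.
have Bh i j : B j i = (B i j)^*.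
  rewrite /B rmorphB /= -hA; congr (_ - _).
  by rewrite [in RHS]rmorphM /= conjCK mulrC.
have Bi0 i : B i ord0 = 0 by rewrite /B u0 rc divfK // subrr.
have B0i i : B ord0 i = 0 by rewrite Bh Bi0 conjC0.
split=> //; split=> // v.
(* Changing the first coordinate of v does not affect the form of B; w has it
   chosen orthogonal to u, so that the forms of B and A agree at w. *)
set w := fun i => if i == ord0 then
  - (\sum_(j < n) (v (lift ord0 j))^* * (A (lift ord0 j) ord0 / r))^* / r
  else v i.
have wl j : w (lift ord0 j) = v (lift ord0 j).
  by rewrite /w eq_sym (negbTE (neq_lift _ _)).
have -> : form B v = form B w.
  by rewrite !form_lift.
have -> : form B w =
    1 * form A w + -1 * form (fun i j => A i ord0 / r * (A j ord0 / r)^*) w.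
  by rewrite -form_lin; apply: eq_form => i j; rewrite mul1r mulN1r.
have -> : form (fun i j => A i ord0 / r * (A j ord0 / r)^*) w = 0.
  rewrite form_rank1 big_ord_recl u0 {1}/w eqxx.
  rewrite rmorphM rmorphN fmorphV /= conjCK rc divfK //.
  under [X in _ + X]eq_bigr do rewrite wl.
  by rewrite addNr normr0 expr0n.
by rewrite mulr0 addr0 mul1r.
Qed.

(** The Schur product theorem: a Schur complement peels a rank-one kernel u u^*
    off A, whose product with B has at v the form of B at the vector with entries
    conj(u_i) v_i; the rest of A lives on a smaller block. *)
Lemma schur_product_form_ge0 n (A B : 'I_n -> 'I_n -> C) :
  psd_kernel A -> (forall v, 0 <= form B v) ->
  forall v, 0 <= form (fun i j => A i j * B i j) v.
Proof.
elim: n A B => [|n IHn] A B psdA posB v; first by rewrite /form big_ord0.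
have [u] := schur_complement psdA; set A1 := fun i j => _ => -[Ai0 A0i psdA1].
have -> : form (fun i j => A i j * B i j) v =
    1 * form (fun i j => u i * (u j)^* * B i j) v
    + 1 * form (fun i j => A1 i j * B i j) v.
  by rewrite -form_lin; apply: eq_form => i j; rewrite /A1; ring.
rewrite !mul1r addr_ge0 //; first by rewrite form_schur_rank1.
rewrite form_lift => [|i|i]; rewrite ?Ai0 ?A0i ?mul0r //.
by apply: IHn => [|w]; [exact: psd_lift|rewrite -form_extend0].
Qed.

Lemma schur_product n (A B : 'I_n -> 'I_n -> C) :
  psd_kernel A -> psd_kernel B -> psd_kernel (fun i j => A i j * B i j).
Proof.
move=> psdA [hB posB]; split=> [i j|]; last exact: schur_product_form_ge0.
by case: psdA => [hA _]; rewrite rmorphM /= -hA -hB.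
Qed.

Lemma psd_exp n (A : 'I_n -> 'I_n -> C) k :
  psd_kernel A -> psd_kernel (fun i j => A i j ^+ k).
Proof.
move=> psdA; elim: k => [|k IHk].
  split=> [i j|v]; first by rewrite conjC1.
  rewrite (_ : form _ _ = form (fun i j => (fun=> 1) i * ((fun=> 1) j)^*) v).
    by rewrite form_rank1 exprn_ge0.
  by apply: eq_form => i j; rewrite conjC1 mul1r.
have [h p] := schur_product psdA IHk.
split=> [i j|v]; first by rewrite !exprS -h.
by rewrite (eq_form v (fun i j => exprS (A i j) k)).
Qed.

End Forms.

(** * The constant and the rank-one inequality *)

(** The constant of the theorem, with weights indexed by all natural numbers and
    valued in the field of matrix entries: the induction on N shifts and rescales the weights, which is
    awkward for weights indexed by ordinals. *)
Definition hook_const (F : numFieldType) (N M : nat) (c : nat -> F) (rho : F) : F :=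
  \sum_(j < N) ('C(M, j) ^ 2)%:R * ('C(M - j - 1, N - j - 1) ^ 2)%:R
               * (rho ^+ (M - j) / c j).

Section HookConst.
Variable F : numFieldType.
Implicit Types (c : nat -> F) (rho : F).

Lemma hook_const_term_gt0 N M c rho (j : 'I_N) : (N <= M)%N -> 0 < rho ->
  0 < c j -> 0 < ('C(M, j) ^ 2)%:R * ('C(M - j - 1, N - j - 1) ^ 2)%:R
               * (rho ^+ (M - j) / c j).
Proof.
move=> leNM rho0 cj0; have ltjN := ltn_ord j.
rewrite mulr_gt0 ?divr_gt0 ?exprn_gt0 //.
by rewrite -natrM ltr0n muln_gt0 !expn_gt0 !bin_gt0; lia.
Qed.

Lemma hook_const_gt0 N M c rho : (0 < N <= M)%N -> 0 < rho ->
  (forall j, (j < N)%N -> 0 < c j) -> 0 < hook_const N M c rho.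
Proof.
case: N => // N /= leNM rho0 c0; rewrite /hook_const big_ord_recl ltr_pwDl //.
  exact: (@hook_const_term_gt0 N.+1 M c rho ord0 leNM rho0 (c0 _ _)).
by apply: sumr_ge0 => j _; apply/ltW/hook_const_term_gt0 => //; apply: c0.
Qed.

(** The term of index j on the left is (j+1)/(m+1) <= 1 times the term of index
    j+1 on the right, since (m+1) 'C(m, j) = (j+1) 'C(m+1, j+1). *)
Lemma hook_const_deriv n m c rho : (n <= m)%N -> 0 < rho ->
  (forall j, (j < n.+1)%N -> 0 < c j) ->
  hook_const n m (fun j => c j.+1 *+ j.+1) rho *+ m.+1
    <= hook_const n.+1 m.+1 c rho.
Proof.
move=> lenm rho0 c0; rewrite /hook_const big_ord_recl -sumrMnl ler_wpDl //.
  exact/ltW/(@hook_const_term_gt0 n.+1 m.+1 c rho ord0 lenm rho0 (c0 _ _)).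
apply: ler_sum => j _; rewrite lift0 !subSS.
have cj0 : 0 < c j.+1 by apply: c0; rewrite ltnS.
set b := 'C(_ - _ - _, _); set r := rho ^+ _.
have r0 : 0 <= r by rewrite exprn_ge0 ?ltW.
have -> : ('C(m, j) ^ 2)%:R * (b ^ 2)%:R * (r / (c j.+1 *+ j.+1)) *+ m.+1
  = ('C(m, j) * 'C(m.+1, j.+1))%:R * ((b ^ 2)%:R * (r / c j.+1)).
  have := mul_bin_diag m.+1 j; move/(congr1 (fun k => k%:R : F)); rewrite !natrM => h.
  have h' : 'C(m.+1, j.+1)%:R = m.+1%:R * 'C(m, j)%:R / j.+1%:R :> F.
    by rewrite [m.+1.-1]/= in h *; rewrite h mulrC mulKf // pnatr_eq0.
  rewrite -mulr_natr -[c _ *+ _]mulr_natr h'.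
  by field; rewrite gt_eqF //= nat1r pnatr_eq0.
rewrite -[X in _ <= X]mulrA ler_wpM2r ?mulr_ge0 ?ler0n ?invr_ge0 ?(ltW cj0) //.
by rewrite ler_nat -mulnn leq_mul2r binS leq_addl orbT.
Qed.

End HookConst.

Lemma power_sum_hook (F : comNzRingType) n k (u v : 'I_n.+1 -> F) :
  \sum_i v i * u i ^+ (n + k) =
  \sum_(j < n.+1) (-1) ^+ (n + j) * (hook_poly (codom u) k)`_j
                  * \sum_i v i * u i ^+ j.
Proof.
have sz : size (codom u) = n.+1 by rewrite size_codom card_ord.
under [RHS]eq_bigr do rewrite mulr_sumr.
rewrite exchange_big; apply: eq_bigr => i _ /=.
have := hook_poly_interp k (codom_f u i); rewrite sz => ->.
rewrite (horner_coef_wide _ (size_hook_poly _ _)) sz.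
rewrite !mulr_sumr; apply: eq_bigr => j _.
by rewrite [(- u i) ^+ _]exprNn exprD /=; ring.
Qed.

Lemma all2_nseqr (S T : Type) (r : S -> T -> bool) (s : seq S) y :
  all2 r s (nseq (size s) y) = all (r^~ y) s.
Proof. by elim: s => //= x s ->. Qed.

Lemma all2_nseql (S T : Type) (r : S -> T -> bool) (s : seq T) x :
  all2 r (nseq (size s) x) s = all (r x) s.
Proof. by elim: s => //= y s ->. Qed.

Section RankOne.
Variable C : numClosedFieldType.

(** The rank-one case: the squared moduli are the forms of the entrywise powers
    of u u^* at the conjugate of v.  Cauchy-Schwarz is applied to the expansion of
    the moment of order n + k.+1 in those of order at most n. *)
Lemma rank1_bound n k (c : nat -> C) rho (u v : 'I_n.+1 -> C) :
  0 < rho -> (forall j, (j < n.+1)%N -> 0 < c j) ->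
  (forall i, `|u i| ^+ 2 <= rho) ->
  `|\sum_i v i * u i ^+ (n + k.+1)| ^+ 2 <=
  hook_const n.+1 (n + k.+1) c rho
  * \sum_(j < n.+1) c j * `|\sum_i v i * u i ^+ j| ^+ 2.
Proof.
move=> rho0 c0 leu; set M := (n + k.+1)%N.
have ltnM : (n < M)%N by rewrite /M; lia.
have cord (j : 'I_n.+1) : 0 < c j by apply: c0.
set T := fun j : 'I_n.+1 => `|(hook_poly (codom u) k.+1)`_j|.
set S := fun j : 'I_n.+1 => `|\sum_i v i * u i ^+ j|.
apply: le_trans (weighted_cauchy_schwarz (a := T) (b := S) _ _ cord _ _).
- rewrite lerXn2r ?nnegrE ?sumr_ge0 // => [j _|]; first by rewrite /T /S mulr_ge0.
  rewrite power_sum_hook (le_trans (ler_norm_sum _ _ _)) //.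
  by apply: ler_sum => j _; rewrite !normrM normrX normrN1 expr1n mul1r.
- by move=> j; rewrite normr_real.
- by move=> j; rewrite normr_real.
- exact: hook_const_gt0.
apply: ler_sum => j _; rewrite mulrA ler_wpM2r ?invr_ge0 ?(ltW (cord _)) //.
have lejn : (j <= n)%N by rewrite -ltnS.
have coefE := coef_hook_nseq k.+1 (sqrtC rho) lejn.
have -> : ('C(M, j) ^ 2)%:R * ('C(M - j - 1, n.+1 - j - 1) ^ 2)%:R * rho ^+ (M - j)
    = (hook_poly (nseq n.+1 (sqrtC rho)) k.+1)`_j ^+ 2.
  rewrite coefE -/M exprMn [sqrtC _ ^+ _ ^+ _]exprAC sqrtCK; congr (_ * _).
  rewrite subSn // !subn1.
  by rewrite natrM exprMn !natrX.
rewrite /T lerXn2r ?nnegrE //.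
  by rewrite coefE mulr_ge0 ?ler0n ?exprn_ge0 ?sqrtC_ge0 ?(ltW rho0).
apply: hook_poly_coef_le.
have sz : size (codom u) = n.+1 by rewrite size_codom card_ord.
rewrite -[X in nseq X]sz all2_nseqr; apply/allP => _ /codomP[l ->] /=.
by rewrite -(@ler_pXn2r _ 2) ?nnegrE ?sqrtC_ge0 ?sqrtCK ?(ltW rho0).
Qed.

End RankOne.

(** * From rank one to all matrices *)

Section Integration.
Variable R : rcfType.
Local Notation C := R[i].
Local Notation "x %:C" := (real_complex _ x) : ring_scope.

(** The mean value theorem fails for complex-valued functions, but holds for
    each of the two real coordinates f = Re and f = Im; the point t depends on
    the coordinate. *)
Lemma mvt_map_poly (f : C -> R) (P : {poly C}) :
  {morph f : x y / x + y} -> (forall x (t : R), f (x * t%:C) = f x * t) ->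
  exists2 t : R, 0 <= t <= 1 & f P.[1] - f P.[0] = f P^`().[t%:C].
Proof.
move=> fD fZ.
have f0 : f 0 = 0 by have := fZ 0 0; rewrite mul0r mulr0.
have fMn x k : f (x *+ k) = f x *+ k.
  by elim: k => [//|k IHk]; rewrite !mulrSr fD IHk.
have hornerf p t : (map_poly f p).[t] = f p.[t%:C].
  rewrite /map_poly horner_poly horner_coef (big_morph f fD f0).
  by apply: eq_bigr => i _; rewrite -fZ rmorphXn.
have derivf : (map_poly f P)^`() = map_poly f P^`().
  by apply/polyP => i; rewrite coef_deriv !coef_map_id0 // coef_deriv fMn.
have [t] := @poly_mvt _ 0 1 (map_poly f P) ltr01.
rewrite in_itv /= => /andP[/ltW t0 /ltW t1].
rewrite derivf !hornerf subr0 mulr1 => e.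
by exists t; rewrite ?t0 // -e.
Qed.

(** As 0 <= z says that z is real and nonnegative, the imaginary part of P is
    constant on [0, 1] while its real part increases. *)
Lemma poly_deriv_ge0_le (P : {poly C}) :
  (forall t, 0 <= t <= 1 -> 0 <= P^`().[t]) -> P.[0] <= P.[1].
Proof.
move=> dP.
have dPR (t : R) : 0 <= t <= 1 -> 0 <= P^`().[t%:C].
  by move=> /andP[t0 t1]; apply: dP;
    rewrite -(rmorph0 (real_complex R)) -(rmorph1 (real_complex R)) !lecR t0.
have ReD : {morph (@complex.Re R) : x y / x + y} by case=> [? ?] [].
have ImD : {morph (@complex.Im R) : x y / x + y} by case=> [? ?] [].
have ReZ x (t : R) : complex.Re (x * t%:C) = complex.Re x * t.
  by case: x => a b /=; rewrite mulr0 subr0.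
have ImZ x (t : R) : complex.Im (x * t%:C) = complex.Im x * t.
  by case: x => a b /=; rewrite mulr0 add0r.
have [t /dPR + eRe] := mvt_map_poly P ReD ReZ.
have [s /dPR + eIm] := mvt_map_poly P ImD ImZ.
rewrite !lecE /= => /andP[/eqP ds _] /andP[_ dt].
by rewrite -subr_eq0 eIm ds eqxx -subr_ge0 eRe.
Qed.

(** Entrywise, the derivative of H[U + t B] is the Schur product of B with
    H'[U + t B]. *)
Lemma form_horner_mono n (U B : 'I_n -> 'I_n -> C) (H : {poly C}) v :
  (forall t, 0 <= t <= 1 ->
     0 <= form (fun i j => B i j * H^`().[U i j + t * B i j]) v) ->
  form (fun i j => H.[U i j]) v <= form (fun i j => H.[U i j + B i j]) v.
Proof.
move=> dH.
pose P := \sum_i \sum_j ((v i)^* * v j) *: (H \Po ((U i j)%:P + B i j *: 'X)).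
have PE t : P.[t] = form (fun i j => H.[U i j + t * B i j]) v.
  rewrite horner_sum; apply: eq_bigr => i _.
  rewrite horner_sum; apply: eq_bigr => j _.
  by rewrite hornerZ horner_comp !hornerE [B i j * t]mulrC; ring.
have dPE t : P^`().[t] = form (fun i j => B i j * H^`().[U i j + t * B i j]) v.
  rewrite raddf_sum horner_sum; apply: eq_bigr => i _.
  rewrite raddf_sum horner_sum; apply: eq_bigr => j _.
  rewrite /= derivZ deriv_comp derivD derivC derivZ derivX add0r alg_polyC.
  rewrite hornerZ hornerM horner_comp hornerD !hornerC hornerZ hornerX.
  by rewrite [B i j * t]mulrC; ring.
have -> : form (fun i j => H.[U i j]) v = P.[0].
  by rewrite PE; apply: eq_form => i j; rewrite mul0r addr0.
have -> : form (fun i j => H.[U i j + B i j]) v = P.[1].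
  by rewrite PE; apply: eq_form => i j; rewrite mul1r.
by apply: poly_deriv_ge0_le => t t01; rewrite dPE dH.
Qed.

(** The lower bound for arbitrary rank, by induction on the size N; M drops
    together with N because one differentiates once per step. *)
Lemma hadamard_power_bound N M (c : nat -> C) (rho : C)
    (A : 'I_N -> 'I_N -> C) (v : 'I_N -> C) :
  (N <= M)%N -> 0 < rho -> (forall j, (j < N)%N -> 0 < c j) ->
  psd_kernel A -> (forall i j, `|A i j| <= rho) ->
  form (fun i j => A i j ^+ M) v <=
  hook_const N M c rho * form (fun i j => \sum_(k < N) c k * A i j ^+ k) v.
Proof.
move=> + rho0; elim: N M c A v => [|n IHn] [|m] // c A v;
  do ?by rewrite /form !big_ord0 mulr0.
rewrite ltnS => lenm c0 psdA leA; have [hA posA] := psdA.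
set K : C := hook_const _ _ _ _.
pose H : {poly C} := K *: \poly_(k < n.+1) c k - 'X^(m.+1).
have HE z : H.[z] = K * (\sum_(k < n.+1) c k * z ^+ k) + -1 * z ^+ m.+1.
  by rewrite !hornerE horner_poly mulN1r.
have formH (G : 'I_n.+1 -> 'I_n.+1 -> C) w : form (fun i j => H.[G i j]) w =
    K * form (fun i j => \sum_(k < n.+1) c k * G i j ^+ k) w
    - form (fun i j => G i j ^+ m.+1) w.
  by rewrite (eq_form _ (fun i j => HE (G i j))) form_lin mulN1r.
rewrite -subr_ge0 -formH.
(* A = U + B, and t |-> H[U + t B] runs from the rank-one case to A. *)
have [u] := schur_complement psdA.
set B := fun i j => _ => -[Bi0 B0i psdB]; have [hB posB] := psdB.
pose U i j := u i * (u j)^*.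
have UB i j : U i j + B i j = A i j by rewrite /B addrC subrK.
have leu i : `|u i| ^+ 2 <= rho.
  rewrite normCK; apply: le_trans (leA i i).
  by rewrite ger0_norm ?psd_diag_ge0 // -subr_ge0 (psd_diag_ge0 i psdB).
have leU i j : `|U i j| <= rho.
  rewrite normrM norm_conjC -(@ler_pXn2r _ 2) ?nnegrE ?mulr_ge0 ?(ltW rho0) //.
  by rewrite exprMn [rho ^+ 2]expr2 ler_pM ?exprn_ge0.
have HU0 : 0 <= form (fun i j => H.[U i j]) v.
  have UX k : form (fun i j => U i j ^+ k) v = `|\sum_i (v i)^* * u i ^+ k| ^+ 2.
    by rewrite -form_rank1; apply: eq_form => i j; rewrite exprMn rmorphXn.
  rewrite formH subr_ge0 form_sum UX /=.
  have -> : \sum_(k < n.+1) c k * form (fun i j => U i j ^+ k) v =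
      \sum_(k < n.+1) c k * `|\sum_i (v i)^* * u i ^+ k| ^+ 2.
    by apply: eq_bigr => k _; rewrite UX.
  have := @rank1_bound _ n (m - n) c rho u (fun i => (v i)^*) rho0 c0 leu.
  by have -> : (n + (m - n).+1 = m.+1)%N by lia.
apply: le_trans HU0 _.
under [X in _ <= X]eq_form do rewrite -UB.
apply: form_horner_mono => t /andP[t0 t1].
(* B has zero first row and column, so the size drops to n. *)
rewrite form_lift => [|i|i]; rewrite ?Bi0 ?B0i ?mul0r //.
apply: schur_product_form_ge0; first exact: psd_lift.
move=> {}v.
pose G0 i j := U i j + t * B i j.
have psdG0 : psd_kernel G0.
  split=> [i j|w].
    rewrite /G0 /U rmorphD !rmorphM /= conjCK -hB (geC0_conj t0).
    by rewrite [u j * _]mulrC.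
  have -> : form G0 w = 1 * form U w + t * form B w.
    by rewrite -form_lin; apply: eq_form => i j; rewrite mul1r.
  by rewrite form_rank1 mul1r addr_ge0 ?exprn_ge0 ?mulr_ge0.
have leG0 i j : `|G0 i j| <= rho.
  have -> : G0 i j = (1 - t) * U i j + t * A i j by rewrite /G0 -UB; ring.
  have -> : rho = (1 - t) * rho + t * rho by ring.
  have t1' : 0 <= 1 - t by rewrite subr_ge0.
  rewrite (le_trans (ler_normD _ _)) // (normrM (1 - t)) (normrM t).
  by rewrite (ger0_norm t0) (ger0_norm t1') lerD // ler_wpM2l.
pose G i j := G0 (lift ord0 i) (lift ord0 j).
(* The weights of the derivative of the sum of the c_k z^k. *)
pose c' (j : nat) : C := c j.+1 *+ j.+1.
have psdG : psd_kernel G by exact: psd_lift.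
have c'0 j : (j < n)%N -> 0 < c' j by move=> ltjn; rewrite pmulrn_lgt0 ?c0.
have dHE z : H^`().[z] = K * (\sum_(k < n) c' k * z ^+ k) + - m.+1%:R * z ^+ m.
  rewrite derivB derivZ derivXn !hornerE mulNr mulr_natl hornerMn hornerXn.
  congr (K * _ - _).
  rewrite -(horner_poly n c'); congr (_.[_]); apply/polyP => k.
  by rewrite coef_deriv !coef_poly ltnS; case: ifP; rewrite // mul0rn.
rewrite (eq_form _ (fun i j => dHE (G i j))) form_lin mulNr subr_ge0.
set Q := form (fun i j => \sum_(k < n) c' k * G i j ^+ k) v.
have Q0 : 0 <= Q.
  rewrite /Q form_sum sumr_ge0 // => k _; rewrite mulr_ge0 ?(ltW (c'0 _ _)) //.
  by have [_] := psd_exp k psdG.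
have := IHn m c' G v lenm c'0 psdG (fun i j => leG0 _ _); rewrite -/Q => IH.
apply: le_trans (_ : m.+1%:R * (hook_const n m c' rho * Q) <= _).
  by rewrite ler_wpM2l.
rewrite mulrA ler_wpM2r // mulr_natl.
exact: hook_const_deriv.
Qed.

End Integration.

(** * The lower bound *)

Section Bridge.
Variable R : realType.
Local Notation C := R[i].
Local Notation "x %:C" := (real_complex _ x) : ring_scope.
Local Open Scope sesquilinear_scope.

Lemma conjC_realE (x : R) : (x%:C)^* = x%:C.
Proof. exact: conjc_real. Qed.

Lemma mx_formE n (A : 'M[C]_n) (v : 'cV[C]_n) :
  (v ^t* *m A *m v) 0 0 = form A (fun i => v i 0).
Proof.
rewrite mxE /form exchange_big; apply: eq_bigr => j _ /=.
by rewrite mxE mulr_suml; apply: eq_bigr => i _; rewrite !mxE.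
Qed.

Lemma hermsymmx_entryP n (A : 'M[C]_n) :
  reflect (forall i j, A j i = (A i j)^*) (A \is hermsymmx).
Proof.
apply: (iffP (is_hermitianmxP _ _ _)); rewrite expr0 scale1r => hA.
  by move=> i j; rewrite {1}hA !mxE.
by apply/matrixP => i j; rewrite !mxE hA.
Qed.

Lemma psdmxP n (A : 'M[C]_n) : psdmx A <-> psd_kernel A.
Proof.
split=> -[hA posA]; split; try exact/hermsymmx_entryP.
- move=> v; have := posA (\col_i v i); rewrite mx_formE.
  by rewrite /form; under eq_bigr do under eq_bigr do rewrite !mxE.
- by move=> v; rewrite mx_formE.
Qed.

Variables (N : nat) (c : 'I_N -> R).

Definition coef_ext (j : nat) : C := if insub j is Some o then (c o)%:C else 1.

Lemma coef_ext_ord (j : 'I_N) : coef_ext j = (c j)%:C.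
Proof. by rewrite /coef_ext valK. Qed.

Lemma coef_ext_gt0 : (forall j, 0 < c j) -> forall j, 0 < coef_ext j.
Proof. by move=> c0 j; rewrite /coef_ext; case: insubP => // o _ _; rewrite ltcR. Qed.

Lemma hadamard_polyE (A : 'M[C]_N) i j :
  hadamard_poly c A i j = \sum_(k < N) coef_ext k * A i j ^+ k.
Proof.
by rewrite summxE; apply: eq_bigr => k _; rewrite !mxE coef_ext_ord.
Qed.

Lemma sharp_constE M (rho : R) :
  (sharp_const c M rho)%:C = hook_const N M coef_ext rho%:C.
Proof.
rewrite rmorph_sum; apply: eq_bigr => j _.
by rewrite coef_ext_ord !rmorphM !rmorph_nat fmorphV rmorphXn.
Qed.

Lemma sharp_const_gt0 M (rho : R) : (0 < N <= M)%N -> 0 < rho ->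
  (forall j, 0 < c j) -> 0 < sharp_const c M rho.
Proof.
move=> NM rho0 c0; rewrite -ltcR sharp_constE hook_const_gt0 ?ltcR //.
by move=> j _; exact: coef_ext_gt0.
Qed.

Lemma qformE (A : 'M[C]_N) v : qform A v = complex.Re (form A (fun i => v i 0)).
Proof. by rewrite /qform mx_formE. Qed.

Lemma qform_bound M (rho : R) (A : 'M[C]_N) v : (N <= M)%N -> 0 < rho ->
  (forall j, 0 < c j) -> psd_over (closed_disc rho) A ->
  0 <= qform (hadamard_exp A M) v
    <= sharp_const c M rho * qform (hadamard_poly c A) v.
Proof.
move=> NM rho0 c0 [/psdmxP psdA leA]; rewrite !qformE.
set w := fun i => v i 0.
have psdM := psd_exp M psdA.
have := @hadamard_power_bound R N M coef_ext rho%:C A w NM.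
rewrite ltcR -sharp_constE => /(_ rho0 (fun j _ => coef_ext_gt0 c0 j) psdA leA).
rewrite -(eq_form w (hadamard_polyE A)).
have EM i j : hadamard_exp A M i j = A i j ^+ M by rewrite mxE.
rewrite -(eq_form w EM).
have := psdM.2 w; rewrite -(eq_form w EM).
rewrite !lecE /= => /andP[_ ->] /andP[_].
by case: (form (hadamard_poly c A) w) => a b /=; rewrite mul0r subr0.
Qed.

Lemma inf_rayleigh_ge M (rho : R) (A : 'M[C]_N) : (0 < N <= M)%N -> 0 < rho ->
  (forall j, 0 < c j) -> psd_over (closed_disc rho) A ->
  (((sharp_const c M rho)^-1)%:E <= inf_rayleigh c M A)%E.
Proof.
move=> NM rho0 c0 psdA; apply/ereal_infP => _ [v _ <-].
have K0 := sharp_const_gt0 NM rho0 c0.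
have /andP[D0 leD] := @qform_bound M rho A v (andP NM).2 rho0 c0 psdA.
rewrite /rayleigh; case: eqVneq => [_|Dn0]; first by rewrite leey.
have Dp : 0 < qform (hadamard_exp A M) v by rewrite lt_def Dn0.
by rewrite lee_fin ler_pdivlMr // mulrC ler_pdivrMr // mulrC.
Qed.

End Bridge.

(** * Sharpness *)

(** Quantifies how close the nodes must be to sqrt rho in [sharpness]. *)
Lemma bernoulli_le (F : realDomainType) (x : F) n : 0 <= x <= 1 ->
  1 - x *+ n <= (1 - x) ^+ n.
Proof.
move=> /andP[x0 x1]; elim: n => [|n IHn]; first by rewrite subr0.
rewrite exprS; apply: le_trans (ler_wpM2l _ IHn); rewrite ?subr_ge0 // -subr_ge0.
have -> : (1 - x) * (1 - x *+ n) - (1 - x *+ n.+1) = x * (x *+ n).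
  by rewrite mulrSr; ring.
by rewrite mulr_ge0 ?mulrn_wge0.
Qed.

Section Sharpness.
Variable R : realType.
Local Notation C := R[i].
Local Notation "x %:C" := (real_complex _ x) : ring_scope.
Local Open Scope sesquilinear_scope.

Lemma vandermonde_unit n (u : 'I_n -> R) :
  injective u -> Vandermonde n (\row_i u i) \in unitmx.
Proof.
move=> u_inj; rewrite unitmxE det_Vandermonde unitfE.
apply/prodf_neq0 => i _; apply/prodf_neq0 => j ltij.
by rewrite !mxE subr_eq0 (inj_eq u_inj) -(inj_eq val_inj) gtn_eqF.
Qed.

Definition real_rank1 n (u : 'I_n -> R) : 'M[C]_n := \matrix_(i, j) (u i * u j)%:C.

Lemma real_rank1_psd1 n (u : 'I_n -> R) (rho : R) :
  (forall i, 0 < u i /\ u i ^+ 2 < rho) ->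
  psd1_over (open_segment rho) (real_rank1 u).
Proof.
move=> hu; split; first split; first apply/psdmxP.
- split=> [i j|v]; first by rewrite !mxE conjC_realE mulrC.
  have -> : form (real_rank1 u) v
      = form (fun i j => (u i)%:C * ((u j)%:C)^*) v.
    by apply: eq_form => i j; rewrite mxE conjC_realE -rmorphM.
  by rewrite form_rank1 exprn_ge0.
- move=> i j; exists (u i * u j); last by rewrite mxE.
  have [ui0 uir] := hu i; have [uj0 ujr] := hu j.
  rewrite /= mulr_gt0 //= -(@ltr_pXn2r _ 2) ?nnegrE ?mulr_ge0 ?ltW //.
    by rewrite exprMn [rho ^+ 2]expr2 ltr_pM ?exprn_ge0 ?ltW.
  by rewrite (le_lt_trans _ uir) ?sqr_ge0.
- have -> : real_rank1 u = (\col_i (u i)%:C) *m (\row_j (u j)%:C).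
    by apply/matrixP => i j; rewrite !mxE big_ord1 !mxE rmorphM.
  exact: mulmx_max_rank.
Qed.

Lemma form_real_rank1_exp n (u : 'I_n -> R) (x : 'cV[R]_n) k :
  form (fun i j => real_rank1 u i j ^+ k) (fun i => map_mx (real_complex R) x i 0)
  = ((\sum_i x i 0 * u i ^+ k) ^+ 2)%:C.
Proof.
rewrite rmorphXn /= rmorph_sum.
have -> : form (fun i j => real_rank1 u i j ^+ k)
    (fun i => map_mx (real_complex R) x i 0) =
    form (fun i j => (u i)%:C ^+ k * (u j)%:C ^+ k)
    (fun i => map_mx (real_complex R) x i 0).
  by apply: eq_form => i j; rewrite mxE rmorphM exprMn.
rewrite form_outer expr2; congr (_ * _); apply: eq_bigr => i _;
  rewrite mxE rmorphM rmorphXn //=.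
- by rewrite conjC_realE.
- by rewrite mulrC.
Qed.

(** The form of A^k at a real vector x is the square of the k-th moment of x on
    the nodes.  Choosing the moments t_j of order j < n+1 proportional to the
    interpolation coefficients divided by c_j gives equality in Cauchy-Schwarz:
    the numerator is S and the denominator is S^2. *)
Lemma inf_rayleigh_real_rank1 n k (c : 'I_n.+1 -> R) (u : 'I_n.+1 -> R) :
  injective u -> (forall j, 0 < c j) ->
  let S := \sum_(j < n.+1) (hook_poly (codom u) k)`_j ^+ 2 / c j in
  0 < S -> (inf_rayleigh c (n + k) (real_rank1 u) <= (S^-1)%:E)%E.
Proof.
move=> u_inj c0 S S0; set A := real_rank1 u.
set T := fun j : nat => (hook_poly (codom u) k)`_j.
have Vu := vandermonde_unit u_inj; set V := Vandermonde _ _ in Vu.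
pose t : 'cV[R]_n.+1 := \col_j ((-1) ^+ (n + j) * T j / c j).
pose x := invmx V *m t.
have xt (j : 'I_n.+1) : \sum_i x i 0 * u i ^+ j = t j 0.
  have <- : V *m x = t by rewrite mulKVmx.
  by rewrite mxE; apply: eq_bigr => i _; rewrite !mxE mulrC.
have tE (j : 'I_n.+1) : t j 0 = (-1) ^+ (n + j) * T j / c j by rewrite mxE.
have xM : \sum_i x i 0 * u i ^+ (n + k) = S.
  rewrite power_sum_hook; apply: eq_bigr => j _; rewrite xt tE -/(T j).
  transitivity (((-1) ^+ (n + j)) ^+ 2 * (T j ^+ 2 / c j));
    last by rewrite sqrr_sign mul1r.
  by rewrite -/(T j); ring.
pose v := map_mx (real_complex R) x.
have qM : qform (hadamard_exp A (n + k)) v = S ^+ 2.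
  rewrite qformE -xM.
  have EM i j : hadamard_exp A (n + k) i j = A i j ^+ (n + k) by rewrite mxE.
  by rewrite (eq_form _ EM) form_real_rank1_exp.
have qF : qform (hadamard_poly c A) v = S.
  rewrite qformE (eq_form _ (hadamard_polyE c A)) form_sum.
  have -> : \sum_(j < n.+1) coef_ext c j * form (fun i l => A i l ^+ j) (fun i => v i 0)
      = S%:C.
    rewrite rmorph_sum; apply: eq_bigr => j _.
    rewrite form_real_rank1_exp coef_ext_ord -rmorphM xt tE; congr (_%:C).
    rewrite !exprMn sqrr_sign mul1r -/(T j).
    by field; rewrite gt_eqF.
  by [].
apply: ereal_inf_lbound; exists v; last first.
  rewrite /rayleigh qM qF expf_eq0 /= gt_eqF // expr2 invfM mulrA divff ?mul1r //.
  by rewrite gt_eqF.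
split; last first.
  move=> v0; move: qM; rewrite v0 /qform mulmx0 mxE => /eqP.
  by rewrite eq_sym expf_eq0 /= gt_eqF.
move=> y Fy.
have sy (j : 'I_n.+1) : \sum_i (y i 0)^* * (u i ^+ j)%:C = 0.
  have : form (hadamard_poly c A) (fun i => y i 0) = 0.
    by rewrite -mx_formE -mulmxA Fy mulmx0 mxE.
  rewrite (eq_form _ (hadamard_polyE c A)) form_sum => /eqP.
  have yj (l : 'I_n.+1) : form (fun i m => A i m ^+ l) (fun i => y i 0)
      = `|\sum_i (y i 0)^* * (u i ^+ l)%:C| ^+ 2.
    rewrite -form_rank1; apply: eq_form => i m.
    by rewrite mxE rmorphM exprMn !rmorphXn /= conjC_realE.
  rewrite psumr_eq0 => [/allP /(_ j)|l _]; last first.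
    by rewrite yj mulr_ge0 ?exprn_ge0 // ltW // coef_ext_gt0.
  rewrite mem_index_enum yj mulf_eq0 gt_eqF ?coef_ext_gt0 //= => /(_ isT).
  by rewrite expf_eq0 /= normr_eq0 => /eqP.
(* v is a combination of the vectors u^j, to which ker F(A) is orthogonal. *)
pose w := invmx V^T *m x.
have xw : V^T *m w = x by rewrite mulKVmx // unitmx_tr.
have xi i : x i 0 = \sum_(j < n.+1) u i ^+ j * w j 0.
  by rewrite -[in LHS]xw mxE; apply: eq_bigr => j _; rewrite !mxE.
have -> : (y ^t* *m v) 0 0 =
    \sum_i \sum_(j < n.+1) (y i 0)^* * (u i ^+ j)%:C * (w j 0)%:C.
  rewrite mxE; apply: eq_bigr => i _.
  have -> : v i 0 = (x i 0)%:C by rewrite mxE.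
  rewrite xi rmorph_sum mulr_sumr !mxE.
  by apply: eq_bigr => j _; rewrite rmorphM mulrA.
by rewrite exchange_big big1 // => j _; rewrite -mulr_suml sy mul0r.
Qed.

(** With all nodes between sqrt rho (1 - x) and sqrt rho, homogeneity of the hook
    Schur polynomials costs a factor of at least (1 - x)^(2 M) in the sum of their
    squares; x is chosen so that this factor is at least q. *)
Lemma sharpness N M (c : 'I_N -> R) (rho q : R) : (0 < N <= M)%N ->
  0 < rho -> (forall j, 0 < c j) -> 0 < q < 1 ->
  exists2 A, psd1_over (open_segment rho) A &
    (inf_rayleigh c M A <= ((q * sharp_const c M rho)^-1)%:E)%E.
Proof.
case: N c => // n c /= ltnM rho0 c0 /andP[q0 q1].
have -> : M = (n + (M - n.+1).+1)%N by lia.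
move: (M - n.+1)%N => k {ltnM}; clear M; set M := (n + k.+1)%N.
have K0 : 0 < sharp_const c M rho by apply: sharp_const_gt0 => //; rewrite /M; lia.
pose x : R := (1 - q) / (M * 2)%:R.
have M2 : 0 < (M * 2)%:R :> R by rewrite ltr0n /M; lia.
have x0 : 0 < x by rewrite divr_gt0 ?subr_gt0.
have x1 : x < 1.
  rewrite ltr_pdivrMr // mul1r (@lt_le_trans _ _ 1) ?gtrBl //.
  by rewrite ler1n muln_gt0 /M addnS.
have qx : q <= (1 - x) ^+ (M * 2).
  have x01 : 0 <= x <= 1 by rewrite !ltW.
  apply: le_trans (bernoulli_le _ x01).
  by rewrite -mulr_natr divfK ?gt_eqF // opprB addrC subrK.
pose s := Num.sqrt rho.
have s0 : 0 < s by rewrite sqrtr_gt0.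
have ss : s ^+ 2 = rho by rewrite sqr_sqrtr ?ltW.
pose u (i : 'I_n.+1) := s * (1 - x * (i.+1%:R / n.+2%:R)).
have i01 (i : 'I_n.+1) : 0 < (i.+1%:R / n.+2%:R : R) < 1.
  by rewrite divr_gt0 ?ltr0n //= ltr_pdivrMr ?ltr0n // mul1r ltr_nat ltnS.
have u_inj : injective u.
  move=> i j /(mulfI (lt0r_neq0 s0)) /addrI /oppr_inj /(mulfI (lt0r_neq0 x0)).
  have n2 : n.+2%:R^-1 != 0 :> R by rewrite invr_eq0 pnatr_eq0.
  by move=> /(mulIf n2) /eqP; rewrite eqr_nat => /eqP[] /val_inj.
have u_lo i : s * (1 - x) <= u i.
  have /andP[_ i1] := i01 i.
  by rewrite ler_pM2l // lerD2l lerN2 ger_pMr // ltW.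
have u_hi i : u i < s.
  have /andP[i0 _] := i01 i.
  by rewrite gtr_pMr // gtrBl mulr_gt0.
have lo0 : 0 < s * (1 - x) by rewrite mulr_gt0 ?subr_gt0.
exists (real_rank1 u).
  apply: real_rank1_psd1 => i; have ui0 := lt_le_trans lo0 (u_lo i); split=> //.
  by rewrite -ss ltr_pXn2r ?nnegrE ?ltW.
have leS : q * sharp_const c M rho <=
    \sum_(j < n.+1) (hook_poly (codom u) k.+1)`_j ^+ 2 / c j.
  rewrite mulr_sumr; apply: ler_sum => j _.
  rewrite [_ * (rho ^+ _ / _)]mulrA mulrA ler_wpM2r ?invr_ge0 ?(ltW (c0 j)) //.
  have lejn : (j <= n)%N by rewrite -ltnS.
  have coefE := coef_hook_nseq k.+1 (s * (1 - x)) lejn.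
  apply: (@le_trans _ _ ((hook_poly (nseq n.+1 (s * (1 - x))) k.+1)`_j ^+ 2)).
    rewrite coefE -/M exprMn natrM exprMn [(s * _) ^+ _]exprMn exprMn.
    rewrite [s ^+ _ ^+ _]exprAC ss !natrX subSn // !subn1 succnK.
    rewrite mulrC [X in _ <= X]mulrA ler_wpM2l //.
      by rewrite !mulr_ge0 ?sqr_ge0 ?exprn_ge0 ?(ltW rho0).
    apply: le_trans qx _; rewrite -exprM ler_wiXn2l ?subr_ge0 ?(ltW x1) //.
      by rewrite lerBlDr lerDl ltW.
    by rewrite leq_mul2r leq_subr.
  have pos : 0 <= (hook_poly (nseq n.+1 (s * (1 - x))) k.+1)`_j.
    by rewrite coefE mulr_ge0 ?ler0n ?exprn_ge0 ?(ltW lo0).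
  have le1 : `|(hook_poly (nseq n.+1 (s * (1 - x))) k.+1)`_j|
      <= (hook_poly (codom u) k.+1)`_j.
    apply: hook_poly_coef_le.
    have sz : size (codom u) = n.+1 by rewrite size_codom card_ord.
    rewrite -[X in nseq X]sz all2_nseql; apply/allP => _ /codomP[l ->] /=.
    by rewrite ger0_norm ?(ltW lo0).
  rewrite lerXn2r ?nnegrE ?(le_trans (normr_ge0 _) le1) //.
  by rewrite (le_trans (ler_norm _) le1).
have S0 := lt_le_trans (mulr_gt0 q0 K0) leS.
apply: le_trans (inf_rayleigh_real_rank1 u_inj c0 S0) _.
by rewrite lee_fin lef_pV2 ?posrE // mulr_gt0.
Qed.

End Sharpness.

Theorem theorem1p6 (R : realType) (rho : R) (M N : nat) (c : 'I_N -> R)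
    (hrho : 0 < rho) (hN : (1 <= N)%N) (hNM : (N <= M)%N)
    (hc : forall j : 'I_N, 0 < c j) :
  (forall A : 'M[R[i]]_N, psd_over (closed_disc rho) A -> A <> 0 ->
     (((sharp_const c M rho)^-1)%:E <= inf_rayleigh c M A)%E) /\
  ereal_inf [set inf_rayleigh c M A | A in psd_over (closed_disc rho) `\ 0]
    = ((sharp_const c M rho)^-1)%:E /\
  ereal_inf [set inf_rayleigh c M A | A in psd1_over (open_segment rho)]
    = ((sharp_const c M rho)^-1)%:E.
Proof.
have NM : (0 < N <= M)%N by rewrite hN.
set K := sharp_const c M rho.
have K0 : 0 < K by exact: sharp_const_gt0.
have lower A : psd_over (closed_disc rho) A ->
    ((K^-1)%:E <= inf_rayleigh c M A)%E.
  exact: inf_rayleigh_ge.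
have sub : psd1_over (open_segment rho) `<=`
    psd_over (closed_disc rho) `\ (0 : 'M[R[i]]_N).
  move=> A [[psdA segA] _]; split; first split=> // i j.
    have [x /andP[x0 xr] <-] := segA i j.
    by rewrite /closed_disc /= ger0_norm ?lecR ?ler0c ltW.
  move=> A0; case: (segA (Ordinal hN) (Ordinal hN)) => x /andP[x0 _].
  by rewrite A0 mxE => -[xE]; rewrite xE ltxx in x0.
have upper : (ereal_inf [set inf_rayleigh c M A | A in psd1_over (open_segment rho)]
    <= (K^-1)%:E)%E.
  apply/lee_addgt0Pr => e e0.
  pose q := K^-1 / (K^-1 + e).
  have Ki : 0 < K^-1 by rewrite invr_gt0.
  have Ke : 0 < K^-1 + e by rewrite addr_gt0.
  have q01 : 0 < q < 1.
    by rewrite divr_gt0 //= ltr_pdivrMr // mul1r ltrDl.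
  have qK : (q * K)^-1 = K^-1 + e.
    by rewrite /q mulrAC mulVf ?gt_eqF // mul1r invrK.
  have [A psdA leA] := sharpness NM hrho hc q01; move: leA; rewrite -/K qK => leA.
  by apply: le_trans leA; apply: ereal_inf_lbound; exists A.
have incl : (ereal_inf [set inf_rayleigh c M A |
      A in psd_over (closed_disc rho) `\ (0%R : 'M[R[i]]_N)]
    <= ereal_inf [set inf_rayleigh c M A | A in psd1_over (open_segment rho)])%E.
  by apply: ereal_inf_le_tmp; exact: image_subset.
have ge1 : ((K^-1)%:E <= ereal_inf [set inf_rayleigh c M A |
      A in psd_over (closed_disc rho) `\ (0%R : 'M[R[i]]_N)])%E.
  by apply/ereal_infP => _ [A [psdA _] <-]; exact: lower.
split; first by move=> A psdA _; exact: lower.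
split; apply/eqP; rewrite eq_le; apply/andP; split=> //.
- exact: le_trans incl upper.
- exact: le_trans ge1 incl.
Qed.
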